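(* Let $K$ be a connected $d$-periodic graph with translation group $T\cong\mathbb{Z}^d$ and quotient graph $q(K)=K/T$. Suppose $q(K)$ has $\varepsilon$ edges and $\nu$ vertices with $\varepsilon-\nu+1=g>d$. Let $w:\pi_1(q(K),v)\to T$ be the weight homomorphism, and let $$s=\min_{L}\ \min\{|S| : S\subseteq \{w(\ell):\ell\in L\},\ S \text{ generates } T \text{ as an abelian group}\},$$ where $L=\{\ell_1,\dots,\ell_g\}$ ranges over the minimal generating sets of loops of $\pi_1(q(K),v)$, so that $d\le s\le g$. Then $H_1(K,\mathbb{Z})$ is generated by $g-d+\binom{s}{2}$ cycles up to translation.
   Context: A $d$-periodic graph ($d>0$) is a locally finite 1-dimensional cell complex $K$ immersed in $\mathbb{R}^l$, $l\ge d$, with a free action of a group $T\cong\mathbb{Z}^d$ by translations preserving the cell structure, a basis $\mathbf{t}_1,\dots,\mathbf{t}_d$ of $T$ being realised by $d$ linearly independent translations of $\mathbb{R}^l$. The quotient $q(K)=K/T$ is a finite graph (loops and multiple edges allowed), and $q:K\to q(K)$ is the quotient map, a normal covering. Weights: enumerate the vertices of $q(K)$ as $v_1,\dots,v_\nu$ and choose representatives $\tilde v_i\in q^{-1}(v_i)$. Every vertex $a$ of $K$ is uniquely $a=\mathbf{t}_a(\tilde v_i)$ with $\mathbf{t}_a\in T$. Each edge of $q(K)$ joining $v_i$ and $v_j$, $i\le j$, is directed from $v_i$ to $v_j$ (loops are given an arbitrary direction). If $(a,b)$ is any lift of the directed edge $e$ to $K$, with $a$ lying over the initial and $b$ over the terminal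 vertex of $e$, then $w(e)=\mathbf{t}_b-\mathbf{t}_a\in T$ (independent of the lift). Extend $w$ to edge-paths additively, with $w(p^{-1})=-w(p)$; this gives a homomorphism $w:\pi_1(q(K),v)\to T$ for any vertex $v$. ''$H_1(K,\mathbb{Z})$ is generated by $m$ cycles up to translation'' means there are $c_1,\dots,c_m\in H_1(K,\mathbb{Z})$ such that the translates $\{\mathbf{t}_*(c_i):\mathbf{t}\in T,\ 1\le i\le m\}$ generate $H_1(K,\mathbb{Z})$ as an abelian group. (It is not claimed that $m$ is minimal.) *)

(* Defs.v *)
From HB Require Import structures.
From mathcomp Require Import all_boot all_order all_algebra.
From mathcomp Require Import finmap.
From mathcomp Require Import all_classical all_reals all_analysis.
Import Order.TTheory GRing.Theory Num.Theory.
Import numFieldNormedType.Exports.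

Set Implicit Arguments.
Unset Strict Implicit.
Unset Printing Implicit Defensive.

Local Open Scope classical_set_scope.
Local Open Scope ring_scope.
Local Open Scope quotient_scope.

(* Graphs in the sense of Serre, i.e. combinatorial 1-dimensional cell
   complexes with loops and multiple edges allowed: a dart is a 1-cell together
   with a direction, [inv] reverses the direction. *)
Record graph := Graph {
  vertex : choiceType;
  dart : choiceType;
  src : dart -> vertex;
  inv : dart -> dart;
  invK : involutive inv;
  inv_neq : forall x, inv x != x
}.
Arguments src {g}.
Arguments inv {g}.

Section Graph.
Variable G : graph.
Implicit Types (u v : vertex G) (x : dart G) (p q : seq (dart G)).

Definition tgt x : vertex G := src (inv x).

(* the undirected edges, i.e. the 1-cells *)
Definition edges : set (set (dart G)) := [set [set x; inv x] | x in setT].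

Definition locally_finite := forall v, finite_set [set x : dart G | src x = v].

Fixpoint is_path u p v : Prop :=
  if p is x :: p' then src x = u /\ is_path (tgt x) p' v else u = v.

Definition connected_graph := forall u v, exists p, is_path u p v.

Definition rev_path p := rev (map inv p).

(* homotopy relative to the end points of edge-paths from u to v *)
Inductive homotopic u v : seq (dart G) -> seq (dart G) -> Prop :=
| HomotopicRefl p : is_path u p v -> homotopic u v p p
| HomotopicSym p q : homotopic u v p q -> homotopic u v q p
| HomotopicTrans p q r :
    homotopic u v p q -> homotopic u v q r -> homotopic u v p r
| HomotopicBacktrack p x q : is_path u (p ++ x :: inv x :: q) v ->
    homotopic u v (p ++ x :: inv x :: q) (p ++ q).

(* The elements of pi_1(G, v) are the classes of loops at v modulo
   [homotopic v v]; [L] is a family of representatives. *)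
Definition generates_pi1 v (L : seq (seq (dart G))) : Prop :=
  (forall p, p \in L -> is_path v p v) /\
  (forall p, is_path v p v ->
     exists2 ps : seq (seq (dart G)),
       (forall q, q \in ps -> q \in L \/ rev_path q \in L) &
       homotopic v v p (flatten ps)).

(* "Minimal" means of least cardinality. *)
Definition minimal_generating_pi1 v (L : seq (seq (dart G))) : Prop :=
  generates_pi1 v L /\
  (forall L', generates_pi1 v L' -> (size L <= size L')%N).

(* Cellular 1-chains with integer coefficients: C_1 is the group of finitely
   supported functions on darts that change sign when the dart is reversed. The
   value of such a function at a dart is the coefficient of the underlying cell
   with that direction. *)
Definition is_chain (c : dart G -> int) : Prop :=
  finite_set [set x | c x != 0] /\ (forall x, c (inv x) = - c x).

(* The coefficient of v in the boundary of c: summing over all the darts that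
   end at v accounts both for the edges entering and for those leaving v. *)
Definition boundary (c : dart G -> int) v : int :=
  \sum_(x \in [set x | tgt x = v]) c x.

(* There are no 2-cells, hence H_1 is the group of 1-cycles. *)
Definition H1 : set (dart G -> int) :=
  [set c | is_chain c /\ forall v, boundary c v = 0].

End Graph.

Arguments edges G : clear implicits.
Arguments H1 G : clear implicits.

Definition is_subgroup (A : zmodType) (H : set A) : Prop :=
  H 0 /\ (forall a b, H a -> H b -> H (a - b)).

Definition subgroup_gen (A : zmodType) (S : set A) : set A :=
  smallest (@is_subgroup A) S.

Definition is_min (A : set nat) (n : nat) : Prop :=
  A n /\ (forall m, A m -> (n <= m)%N).

(* [T] is 'rV[int]_d, its standard basis being t_1, ..., t_d; row i of [tbasis]
   is the vector of R^l by which t_(i+1) translates. The 1-cell underlying x is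
   mapped to R^l by [curve x] on [0, 1], and K is mapped to R^l by an immersion,
   i.e. a continuous map which is injective near every point: near an interior
   point of a 1-cell ([curve_immersed]) and on a neighbourhood of a vertex in
   its star ([star_immersed]). *)
Record periodic_graph (R : realType) (d l : nat) := PeriodicGraph {
  pgraph :> graph;
  pg_locally_finite : locally_finite pgraph;
  act : 'rV[int]_d -> vertex pgraph -> vertex pgraph;
  actd : 'rV[int]_d -> dart pgraph -> dart pgraph;
  act0 : forall a, act 0 a = a;
  actD : forall t t' a, act (t + t') a = act t (act t' a);
  actd0 : forall x, actd 0 x = x;
  actdD : forall t t' x, actd (t + t') x = actd t (actd t' x);
  actd_src : forall t x, src (actd t x) = act t (src x);
  actd_inv : forall t x, inv (actd t x) = actd t (inv x);
  act_free : forall t a, act t a = a -> t = 0;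
  tbasis : 'M[R]_(d, l);
  tbasis_free : row_free tbasis;
  pos : vertex pgraph -> 'rV[R]_l;
  curve : dart pgraph -> R -> 'rV[R]_l;
  curve_continuous : forall x, {within `[0, 1], continuous (curve x)};
  curve_src : forall x, curve x 0 = pos (src x);
  curve_inv : forall x s, 0 <= s <= 1 -> curve (inv x) s = curve x (1 - s);
  curve_immersed : forall x s, 0 < s < 1 ->
    exists2 e : R, 0 < e & forall s1 s2, 0 <= s1 <= 1 -> 0 <= s2 <= 1 ->
      `|s1 - s| < e -> `|s2 - s| < e -> curve x s1 = curve x s2 -> s1 = s2;
  star_immersed : forall v,
    exists2 e : R, 0 < e & forall x1 x2 s1 s2, src x1 = v -> src x2 = v ->
      0 <= s1 <= 1 -> 0 <= s2 <= 1 -> s1 < e -> s2 < e ->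
      curve x1 s1 = curve x2 s2 ->
      (s1 = 0 /\ s2 = 0) \/ (x1 = x2 /\ s1 = s2);
  pos_act : forall t a, pos (act t a) = pos a + map_mx intr t *m tbasis;
  curve_act : forall t x s, 0 <= s <= 1 ->
    curve (actd t x) s = curve x s + map_mx intr t *m tbasis
}.

Section Quotient.
Variables (R : realType) (d l : nat) (K : periodic_graph R d l).
Local Notation T := 'rV[int]_d.

Definition orbit_rel (X : Type) (f : T -> X -> X) : rel X :=
  fun a b => `[< exists t, b = f t a >].

Lemma orbit_rel_equiv (X : Type) (f : T -> X -> X) :
  (forall a, f 0 a = a) -> (forall t t' a, f (t + t') a = f t (f t' a)) ->
  equiv_class_of (orbit_rel f).
Proof.
move=> f0 fD; split.
- by move=> a; apply/asboolP; exists 0; rewrite f0.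
- have sym a b : orbit_rel f a b -> orbit_rel f b a.
    move=> /asboolP[t ->]; apply/asboolP; exists (- t).
    by rewrite -fD addNr f0.
  by move=> a b; apply/idP/idP => /sym.
- move=> b a c /asboolP[t ->] /asboolP[t' ->]; apply/asboolP.
  by exists (t' + t); rewrite fD.
Qed.

Definition vertex_orbit : equiv_rel (vertex K) :=
  EquivRelPack (orbit_rel_equiv (@act0 _ _ _ K) (@actD _ _ _ K)).
Definition dart_orbit : equiv_rel (dart K) :=
  EquivRelPack (orbit_rel_equiv (@actd0 _ _ _ K) (@actdD _ _ _ K)).

Definition qvertex : choiceType := {eq_quot vertex_orbit}.
Definition qdart : choiceType := {eq_quot dart_orbit}.

(* the quotient map on vertices and on darts *)
Definition qv (a : vertex K) : qvertex := \pi_({eq_quot vertex_orbit}) a.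
Definition qd (x : dart K) : qdart := \pi_({eq_quot dart_orbit}) x.

(* an arbitrary lift of a dart of the quotient *)
Definition qlift (y : qdart) : dart K := repr (y : {eq_quot dart_orbit}).

Lemma qliftK : cancel qlift qd.
Proof. by move=> y; rewrite /qd /qlift; exact: reprK. Qed.

Lemma qvP a b : qv a = qv b <-> exists t, b = act t a.
Proof. by split=> [/eqmodP/asboolP|H]; last exact/eqmodP/asboolP. Qed.

Lemma qdP x y : qd x = qd y <-> exists t, y = actd t x.
Proof. by split=> [/eqmodP/asboolP|H]; last exact/eqmodP/asboolP. Qed.

Definition qsrc (y : qdart) : qvertex := qv (src (qlift y)).
Definition qinv (y : qdart) : qdart := qd (inv (qlift y)).

Lemma qsrcE x : qsrc (qd x) = qv (src x).
Proof.
have /qdP[t xt] := esym (qliftK (qd x)).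
by apply/esym/qvP; exists t; rewrite -actd_src -xt.
Qed.

Lemma qinvE x : qinv (qd x) = qd (inv x).
Proof.
have /qdP[t xt] := esym (qliftK (qd x)).
by apply/esym/qdP; exists t; rewrite -actd_inv -xt.
Qed.

Lemma qinvK : involutive qinv.
Proof. by move=> y; rewrite -(qliftK y) !qinvE invK. Qed.

(* T is torsion-free, hence acts without inversions. *)
Lemma qinv_neq y : qinv y != y.
Proof.
rewrite -(qliftK y) qinvE; apply/eqP => /esym/qdP[t xt].
move: (qlift y) xt => x xt.
have xtt : x = actd (t + t) x by rewrite actdD -xt -actd_inv -xt invK.
have tt0 : t + t = 0.
  by apply: (@act_free _ _ _ K _ (src x)); rewrite -actd_src -xtt.
have t0 : t = 0.
  apply/rowP => j; move/rowP: tt0 => /(_ j); rewrite !mxE -mulr2n => /eqP.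
  by rewrite mulrn_eq0 /= => /eqP.
by move: xt (inv_neq x); rewrite t0 actd0 => ->; rewrite eqxx.
Qed.

Definition quotient_graph : graph :=
  @Graph qvertex qdart qsrc qinv qinvK qinv_neq.

(* The chosen representatives: [vtilde v] lies over v. *)
Definition representatives (vtilde : vertex quotient_graph -> vertex K) :=
  cancel vtilde (qv : vertex K -> vertex quotient_graph).

Variable vtilde : vertex quotient_graph -> vertex K.

(* [vshift a] is t_a, characterised by [vshiftP]. *)
Definition vshift (a : vertex K) : T :=
  xget 0 [set t | a = act t (vtilde (qv a))].

(* Every edge carries both of its directions here and the weight of the reverse
   direction is the opposite one ([weight_inv]), hence no choice of directions
   is needed. The value does not depend on the lift, by [weightE]. *)
Definition weight (y : dart quotient_graph) : T :=
  vshift (tgt (qlift y)) - vshift (src (qlift y)).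

Definition path_weight (p : seq (dart quotient_graph)) : T :=
  \sum_(y <- p) weight y.

Hypothesis vtildeK : representatives vtilde.

Lemma vshiftP a t : vshift a = t <-> a = act t (vtilde (qv a)).
Proof.
have aE : exists t, a = act t (vtilde (qv a)) by apply/qvP; exact: vtildeK.
rewrite /vshift; split=> [<-|at_].
  by case: xgetP => [t' _ //|no]; case: aE => t' /no.
case: xgetP => [t' _ /= at'|]; last by move=> /(_ t).
apply/eqP; rewrite -subr_eq0; apply/eqP.
apply: (@act_free _ _ _ K _ (vtilde (qv a))).
by rewrite addrC actD -at' {1}at_ -actD addNr act0.
Qed.

Lemma vshift_act t a : vshift (act t a) = t + vshift a.
Proof.
apply/vshiftP; rewrite actD; have -> : qv (act t a) = qv a.
  by apply/esym/qvP; exists t.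
by congr act; apply/vshiftP.
Qed.

Lemma tgt_actd t (x : dart K) : tgt (actd t x) = act t (tgt x).
Proof. by rewrite /tgt actd_inv actd_src. Qed.

Lemma weightE (x : dart K) : weight (qd x) = vshift (tgt x) - vshift (src x).
Proof.
rewrite /weight; have /qdP[t ->] := esym (qliftK (qd x)).
by rewrite tgt_actd actd_src !vshift_act opprD addrACA subrr add0r.
Qed.

Lemma weight_inv (y : dart quotient_graph) : weight (inv y) = - weight y.
Proof.
by rewrite -(qliftK y) [inv _]qinvE !weightE /tgt invK opprB.
Qed.

Lemma path_weight_cat p q :
  path_weight (p ++ q) = path_weight p + path_weight q.
Proof. by rewrite /path_weight big_cat. Qed.

Lemma path_weight_rev p : path_weight (rev_path p) = - path_weight p.
Proof.
rewrite /path_weight /rev_path big_rev big_map -sumrN.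
by apply: eq_bigr => y _; exact: weight_inv.
Qed.

(* [path_weight] induces the homomorphism w on pi_1. *)
Lemma path_weight_homotopic u v p q : homotopic u v p q ->
  path_weight p = path_weight q.
Proof.
elim=> {p q} // [p q r _ -> _ ->//|p x q _].
rewrite !path_weight_cat; congr +%R.
by rewrite /path_weight !big_cons weight_inv addrA subrr add0r.
Qed.

End Quotient.

Section MainNotions.
Variables (R : realType) (d l : nat) (K : periodic_graph R d l).
Local Notation T := 'rV[int]_d.

(* the cardinalities of the sets of weights of loops of L that generate T *)
Definition generating_weight_sizes
    (vtilde : vertex (quotient_graph K) -> vertex K)
    (L : seq (seq (dart (quotient_graph K)))) : set nat :=
  [set k | exists S : {fset T},
     [/\ {subset S <= [seq path_weight vtilde p | p <- L]},
         subgroup_gen [set` S] = setT & #|` S| = k]].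

(* [weight_rank vtilde v g s] says that s is the double minimum over the
   minimal generating sets {l_1, ..., l_g} of pi_1(q(K), v). *)
Definition weight_rank (vtilde : vertex (quotient_graph K) -> vertex K)
    (v : vertex (quotient_graph K)) (g s : nat) : Prop :=
  is_min [set k | exists L, [/\ minimal_generating_pi1 v L, size L = g &
                                is_min (generating_weight_sizes vtilde L) k]] s.

Definition translate (t : T) (c : dart K -> int) : dart K -> int :=
  fun x => c (actd (- t) x).

Definition H1_generated_up_to_translation (m : nat) : Prop :=
  exists c : 'I_m -> (dart K -> int),
    (forall i, H1 K (c i)) /\
    subgroup_gen [set z | exists t i, z = translate t (c i)] = H1 K.

End MainNotions.

(* Main.v *)
From Pilot Require Import Defs.
From HB Require Import structures.
From mathcomp Require Import all_boot all_order all_algebra.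
From mathcomp Require Import finmap.
From mathcomp Require Import all_classical all_reals all_analysis.
From mathcomp Require Import zify.
Import Order.TTheory GRing.Theory Num.Theory.
Import numFieldNormedType.Exports.
(* [inv], [invK] and [rev_path] below are those of graphs. *)
Import Pilot.Defs.

Set Implicit Arguments.
Unset Strict Implicit.
Unset Printing Implicit Defensive.

Local Open Scope classical_set_scope.
Local Open Scope card_scope.
Local Open Scope ring_scope.

(** Let G be the quotient graph and w the weight homomorphism from pi_1(G, v) to
    T = Z^d. As K is connected, K is the covering of G that belongs to ker w: the
    loops of K are the lifts of the loops of weight 0, and w is onto. So H_1(K) is
    the abelianisation of ker w, and the action of T on it comes from conjugation
    in pi_1(G, v). Hence, if ker w is the normal closure of some loops, then
    their lifts generate H_1(K) up to translation ([H1_generated_by_kernel]).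

    It remains to find g - d + 'C(s, 2) normal generators of ker w
    ([kernel_normal_generators]). Take a minimal generating set of g loops, s of
    which have weights generating T. Each of the other g - s loops can be
    multiplied by a word in the s chosen ones so that its weight becomes 0.
    Modulo these g - s products, every loop is a word in the s chosen loops;
    modulo their 'C(s, 2) commutators, this word depends on its exponents only,
    a vector of Z^s; and the vectors of weight 0 form the kernel of a surjection
    from Z^s onto Z^d, which is generated by s - d elements ([kermx_int_gen]). The
    total is (g - s) + (s - d) + 'C(s, 2).

    The number s exists since pi_1(G, v) is generated by the g loops of the edges
    outside a spanning tree and by no fewer ([pi1_rank]), and d <= s since fewer
    than d vectors cannot generate Z^d.

    No quotient group is formed. A loop is a sequence of darts, a normal subgroup
    of pi_1(G, v) is a predicate on sequences ([normal_words]), and the lift of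
    a sequence is defined without asking that it be a path. The decisive normal
    subgroup consists of the sequences of weight 0 whose lift has its chain in
    the submodule N of H_1(K) spanned by the translates of the proposed cycles
    ([lift_normal_words]): as it contains the normal generators of ker w, it
    contains all of ker w, so that N is H_1(K). *)

(** * Subgroups of abelian groups and integer matrices *)

Section Subgroup.
Variables (A : zmodType) (H : set A).
Hypothesis sgH : is_subgroup H.

Lemma subgroupN a : H a -> H (- a).
Proof. by case: sgH => H0 HB Ha; rewrite -sub0r; exact: HB. Qed.

Lemma subgroupD a b : H a -> H b -> H (a + b).
Proof.
by case: sgH => _ HB Ha Hb; rewrite -[b]opprK; apply: HB => //; exact: subgroupN.
Qed.

Lemma subgroup_sum (I : Type) (r : seq I) (P : pred I) (F : I -> A) :
  (forall i, P i -> H (F i)) -> H (\sum_(i <- r | P i) F i).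
Proof. by apply: big_ind; [case: sgH | exact: subgroupD]. Qed.

Lemma subgroupMz a (n : int) : H a -> H (a *~ n).
Proof.
move=> Ha; have Hn k : H (a *+ k).
  by elim: k => [|k IH]; [rewrite mulr0n; case: sgH | rewrite mulrS; exact: subgroupD].
by case: n => n; [exact: Hn | apply: subgroupN; exact: Hn].
Qed.

End Subgroup.

Lemma subgroup_gen_subgroup (A : zmodType) (S : set A) :
  is_subgroup (subgroup_gen S).
Proof.
split=> [H [[H0 _] _]//|a b Sa Sb H HS].
by case: (HS) => -[_ HB] _; apply: HB; [exact: Sa | exact: Sb].
Qed.

Lemma mem_subgroup_gen (A : zmodType) (S : set A) : S `<=` subgroup_gen S.
Proof. exact: sub_smallest. Qed.

Lemma subgroup_gen_min (A : zmodType) (S H : set A) :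
  is_subgroup H -> S `<=` H -> subgroup_gen S `<=` H.
Proof. by move=> sgH SH a; apply; split. Qed.

Lemma subgroup_gen_coef (A : zmodType) (r : seq A) (S : set A) a :
  (forall b, S b -> b \in r) -> subgroup_gen S a ->
  exists n : 'rV[int]_(size r), a = \sum_(i < size r) r`_i *~ n 0 i.
Proof.
move=> Sr; move: a; apply: subgroup_gen_min.
  split.
    by exists 0; rewrite big1// => i _; rewrite mxE mulr0z.
  move=> _ _ [m ->] [n ->]; exists (m - n); rewrite -sumrB.
  by apply: eq_bigr => i _; rewrite !mxE mulrzBr.
move=> b /Sr; rewrite -index_mem => br.
exists (delta_mx 0 (Ordinal br)); rewrite (bigD1 (Ordinal br))//= mxE !eqxx.
rewrite big1 ?addr0 ?nth_index -?index_mem// => i.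
by rewrite mxE eqxx /= => /negbTE ->; rewrite mulr0z.
Qed.

Lemma row_mulmxE (m n : nat) (a : 'rV[int]_m) (W : 'M[int]_(m, n)) :
  a *m W = \sum_i row i W *~ a 0 i.
Proof.
rewrite mulmx_sum_row; apply: eq_bigr => i _.
by apply/rowP => j; rewrite -scaler_int !mxE intz.
Qed.

(** In the bases of the Smith normal form, row vectors are multiplied by a
    diagonal s x d matrix. It has a left inverse too, so its d diagonal entries
    are nonzero and the last s - d basis vectors span the kernel. *)
Lemma kermx_int_gen (s d : nat) (A : 'M[int]_(d, s)) (W : 'M[int]_(s, d)) :
  A *m W = 1%:M ->
  exists2 C : 'M[int]_(s - d, s), C *m W = 0 &
    forall n : 'rV_s, n *m W = 0 -> exists a : 'rV_(s - d), n = a *m C.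
Proof.
move=> AW; have ds := mulmx1_min AW.
have [L Lu [P Pu [e _ WE]]] := int_Smith_normal_form W.
set D := (X in L *m X *m _) in WE.
have e_neq0 (j : 'I_d) : e`_j != 0.
  have : (P *m (A *m L *m D)) j j = 1.
    have ALDP : (A *m L *m D) *m P = 1%:M by rewrite -!mulmxA (mulmxA L) -WE.
    by rewrite (mulmx1C ALDP) mxE eqxx.
  rewrite !mulmxA mxE; set sj := widen_ord ds j.
  rewrite (bigD1 sj)//= big1 ?addr0 => [|i ij]; last first.
    rewrite [D _ _]mxE; case: eqP => [ijE|]; last by rewrite mulr0n mulr0.
    by case/eqP: ij; apply: val_inj.
  rewrite [D _ _]mxE eqxx mulr1n; apply: contra_eq_neq => ->.
  by rewrite mulr0 eq_sym oner_eq0.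
have lt_d (i : 'I_(s - d)) : (d + i < s)%N by rewrite -ltn_subRL.
pose f i := Ordinal (lt_d i).
(* The new basis of Z^s consists of the rows of [invmx L]. *)
exists (rowsub f (invmx L)) => [|n].
  rewrite WE -mulmxA mul_rowsub_mx !mulmxA mulVmx// mul1mx.
  apply/matrixP => i j; rewrite !mxE big1// => k _.
  rewrite !mxE; case: eqP => [dik|]; last by rewrite mulr0n mul0r.
  by have := ltn_ord k; rewrite -dik /= ltnNge leq_addr.
rewrite WE !mulmxA => nLDP0.
have nD : n *m L *m D = 0 by rewrite -(mulmxK Pu (n *m L *m D)) nLDP0 mul0mx.
have nL0 (i : 'I_s) : (i < d)%N -> (n *m L) 0 i = 0.
  move=> id; have := congr1 (fun M : 'rV_d => M 0 (Ordinal id)) nD.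
  rewrite mxE [RHS]mxE.
  rewrite (bigD1 i)//= big1 ?addr0 => [|k ki]; last first.
    rewrite [D _ _]mxE; case: eqP => [ijE|]; last by rewrite mulr0n mulr0.
    by case/eqP: ki; apply: val_inj.
  rewrite [D _ _]mxE eqxx mulr1n => /eqP; rewrite mulf_eq0.
  by rewrite (negbTE (e_neq0 (Ordinal id))) orbF => /eqP.
exists (colsub f (n *m L)).
rewrite -[LHS](mulmxK Lu).
have -> : rowsub f (invmx L) = rowsub f 1%:M *m invmx L.
  by rewrite mul_rowsub_mx mul1mx.
rewrite mulmxA; congr mulmx; apply/rowP => j; rewrite [RHS]mxE.
have [jd|dj] := ltnP j d.
  rewrite nL0// big1// => i _; rewrite [rowsub _ _ _ _]mxE [1%:M _ _]mxE -val_eqE/=.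
  case: eqP => [ij|_]; last by rewrite mulr0.
  by rewrite -ij ltnNge leq_addr in jd.
have jd : (j - d < s - d)%N by rewrite ltn_sub2r// (leq_ltn_trans dj).
rewrite (bigD1 (Ordinal jd))//= big1 ?addr0 => [|i ij].
  have fj : f (Ordinal jd) = j by apply: val_inj; rewrite /= subnKC.
  by rewrite [rowsub _ _ _ _]mxE [1%:M _ _]mxE [colsub _ _ _ _]mxE fj eqxx mulr1.
rewrite [rowsub _ _ _ _]mxE [1%:M _ _]mxE; case: eqP => [fij|]; last by rewrite mulr0.
by case/eqP: ij; apply: val_inj; rewrite /= -fij /= addKn.
Qed.

(** * Auxiliary facts about sequences and minima *)

Lemma perm_split_map (X Y : eqType) (f : X -> Y) (r : seq Y) (s : seq X) :
  uniq r -> {subset r <= map f s} ->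
  exists s1 s2, perm_eq s (s1 ++ s2) /\ map f s1 = r.
Proof.
elim: r s => [|y r IH] s /=; first by exists [::], s.
move=> /andP[yr ur] rs.
have /mapP[x xs yE] := rs y (mem_head y r).
have sE := perm_to_rem xs.
have /IH[//|s1 [s2 [remE s1E]]] : {subset r <= map f (rem x s)}.
  move=> z zr; have := rs z; rewrite inE zr orbT => /(_ isT).
  rewrite (perm_mem (perm_map f sE)) /= inE -yE => /orP[/eqP zy|//].
  by rewrite -zy zr in yr.
exists (x :: s1), s2; split; last by rewrite /= s1E yE.
by rewrite (perm_trans sE)//= perm_cons.
Qed.

Lemma size_ltn_pairs n :
  size [seq (i, j) | j <- iota 0 n, i <- iota 0 j] = 'C(n, 2).
Proof.
rewrite size_allpairs_dep -bin2_sum sumnE big_map /index_iota subn0.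
by apply: eq_bigr => i _; rewrite size_iota.
Qed.

Lemma is_min_exists (P : set nat) n : P n -> exists m, is_min P m.
Proof.
move=> Pn; have exP : exists n, `[< P n >] by exists n; apply/asboolP.
case: (ex_minnP exP) => m /asboolP Pm mmin; exists m; split => // k Pk.
by apply: mmin; apply/asboolP.
Qed.

(** * Words in commuting generators *)

Lemma rev_path_cat (G : graph) (p q : seq (dart G)) :
  rev_path (p ++ q) = rev_path q ++ rev_path p.
Proof. by rewrite /rev_path map_cat rev_cat. Qed.

Lemma rev_pathK (G : graph) : involutive (@rev_path G).
Proof.
move=> p; rewrite /rev_path map_rev revK -map_comp map_id_in// => x _ /=.
by rewrite invK.
Qed.

Lemma rev_path_cons (G : graph) x (p : seq (dart G)) :
  rev_path (x :: p) = rev_path p ++ [:: inv x].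
Proof. by rewrite -cat1s rev_path_cat. Qed.

(** The sequences of darts that a homomorphism from the free group on the edges
    sends to 1: the closure conditions are those of a normal subgroup, stated
    for unreduced words. *)
Definition normal_words (G : graph) (Z : seq (dart G) -> Prop) : Prop :=
  [/\ Z [::], (forall x, Z [:: x; inv x]) &
      forall p q r, Z q -> Z (p ++ q ++ r) <-> Z (p ++ r)].

Section NormalWords.
Variables (G : graph) (Z : seq (dart G) -> Prop).
Hypothesis nZ : normal_words Z.
Implicit Types p q r : seq (dart G).

Lemma normal_ins p q r : Z q -> Z (p ++ q ++ r) <-> Z (p ++ r).
Proof. by case: nZ => _ _; apply. Qed.

Lemma normal_cat p q : Z q -> Z (p ++ q) <-> Z p.
Proof. by move=> Zq; have := normal_ins p [::] Zq; rewrite !cats0. Qed.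

Lemma normal_cancel p : Z (p ++ rev_path p).
Proof.
elim: p => [|x p IH]; first by case: nZ.
rewrite rev_path_cons cat_cons catA -cat1s.
by apply/(normal_ins [:: x] [:: inv x] IH); case: nZ => _ Zx _; exact: Zx.
Qed.

Lemma normal_cancel_rev p : Z (rev_path p ++ p).
Proof. by have := normal_cancel (rev_path p); rewrite rev_pathK. Qed.

Lemma normal_rev p : Z p -> Z (rev_path p).
Proof. by move=> Zp; apply/(normal_ins [::] (rev_path p) Zp)/normal_cancel. Qed.

Lemma normal_conj p q : Z q -> Z (p ++ q ++ rev_path p).
Proof. by move=> Zq; apply/(normal_ins p (rev_path p) Zq)/normal_cancel. Qed.

Lemma normal_conj_rev p q : Z q -> Z (rev_path p ++ q ++ p).
Proof. by have := @normal_conj (rev_path p) q; rewrite rev_pathK. Qed.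

Lemma normal_homotopic u v p q : homotopic u v p q -> Z p <-> Z q.
Proof.
elim=> {p q} // [p q _ ->//|p q r _ -> _ ->//|p x q _].
rewrite -(cat1s x) -(cat1s (inv x)) (catA [:: x]); apply: normal_ins.
by case: nZ => _ Zx _; exact: Zx.
Qed.

Definition commutator p q := p ++ q ++ rev_path p ++ rev_path q.

Lemma commutator_sym p q : Z (commutator p q) -> Z (commutator q p).
Proof.
by move=> /normal_rev; rewrite /commutator !rev_path_cat !rev_pathK -!catA.
Qed.

Lemma commutator_cat p q q' :
  Z (commutator p q) -> Z (commutator p q') -> Z (commutator p (q ++ q')).
Proof.
move=> Zq Zq'; rewrite /commutator rev_path_cat.
have [E1 _] := normal_ins (p ++ q)
  (q' ++ rev_path p ++ rev_path q' ++ rev_path q) (normal_cancel_rev p).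
have [_ E2] := normal_ins (p ++ q ++ rev_path p) (rev_path q) Zq'.
by move: E1 E2; rewrite /commutator -!catA => E1 E2; apply/E1/E2.
Qed.

Lemma commutator_rev p q :
  Z (commutator p q) -> Z (commutator p (rev_path q)).
Proof.
move=> /commutator_sym/(normal_conj_rev q); rewrite /commutator -!catA catA => Zq.
have [+ _] := normal_ins [::]
  (p ++ rev_path q ++ rev_path p ++ q) (normal_cancel_rev q).
by rewrite /commutator rev_pathK; exact.
Qed.

(** Words in the generators [ell i] and their inverses; [true] marks an inverse. *)
Section Words.
Variables (s : nat) (ell : 'I_s -> seq (dart G)).
Implicit Types (u : seq ('I_s * bool)) (n : 'rV[int]_s).

Definition eval_letter (a : 'I_s * bool) : seq (dart G) :=
  if a.2 then rev_path (ell a.1) else ell a.1.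

Definition eval_word u : seq (dart G) := flatten (map eval_letter u).

Definition exponents u : 'rV[int]_s :=
  \row_i ((count_mem (i, false) u)%:Z - (count_mem (i, true) u)%:Z).

Definition inv_word u := rev (map (fun a => (a.1, ~~ a.2)) u).

Lemma eval_word_cat u u' : eval_word (u ++ u') = eval_word u ++ eval_word u'.
Proof. by rewrite /eval_word map_cat flatten_cat. Qed.

Lemma eval_inv_word u : eval_word (inv_word u) = rev_path (eval_word u).
Proof.
elim: u => // -[i b] u IH.
rewrite /inv_word map_cons rev_cons -cats1 eval_word_cat [eval_word (rev _)]IH.
rewrite -cat1s eval_word_cat rev_path_cat /eval_word /= !cats0; congr cat.
by case: b; rewrite /eval_letter /= ?rev_pathK.
Qed.

Lemma exponents_cat u u' : exponents (u ++ u') = exponents u + exponents u'.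
Proof. by apply/rowP => i; rewrite !mxE !count_cat; lia. Qed.

Lemma exponents_nil : exponents [::] = 0.
Proof. by apply/rowP => i; rewrite !mxE subrr. Qed.

Lemma exponents1 i b :
  exponents [:: (i, b)] = if b then - delta_mx 0 i else delta_mx 0 i.
Proof.
apply/rowP => j; rewrite !mxE /= !xpair_eqE (eq_sym i) !addn0.
by case: b; rewrite ?andbT ?andbF !mxE eqxx /= ?sub0r ?subr0; case: (j == i).
Qed.

Lemma exponents_inv u : exponents (inv_word u) = - exponents u.
Proof.
elim: u => [|[i b] u IH]; first by rewrite exponents_nil oppr0.
rewrite /inv_word map_cons rev_cons -cats1 -(cat1s (i, b)) !exponents_cat.
by rewrite [exponents (rev _)]IH opprD addrC !exponents1; case: b; rewrite ?opprK.
Qed.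

Lemma exponents_subgroup (P : seq ('I_s * bool) -> Prop) : P [::] ->
  (forall u u', P u -> P u' -> P (u ++ inv_word u')) ->
  is_subgroup [set n | exists2 u, exponents u = n & P u].
Proof.
move=> P0 PB; split; first by exists [::]; rewrite ?exponents_nil.
move=> _ _ [u <- Pu] [u' <- Pu']; exists (u ++ inv_word u'); last exact: PB.
by rewrite exponents_cat exponents_inv.
Qed.

Lemma exponents_surj n : exists u, exponents u = n.
Proof.
have sg : is_subgroup [set n | exists2 u, exponents u = n & True].
  exact: exponents_subgroup.
suff [u uE _] : [set n | exists2 u, exponents u = n & True] n by exists u.
rewrite (row_sum_delta n); apply: (subgroup_sum sg) => i _.
rewrite -[n 0 i]intz scaler_int; apply: (subgroupMz sg) => /=.
by exists [:: (i, false)]; rewrite ?exponents1.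
Qed.

(** In an abelian group a word is trivial as soon as each generator has total
    exponent 0: the first letter occurs later with the opposite sign, and
    commuting the two together cancels them. *)
Lemma normal_exponents0 u :
  (forall i j : 'I_s, (i < j)%N -> Z (commutator (ell i) (ell j))) ->
  exponents u = 0 -> Z (eval_word u).
Proof.
move=> Zcomm; have Zl i a : Z (commutator (ell i) (eval_letter a)).
  suff Zij j : Z (commutator (ell i) (ell j)).
    by case: a => j []; rewrite /eval_letter //=; apply: commutator_rev.
  have [ij|ji|/val_inj <-] := ltngtP i j; first exact: Zcomm.
    by apply: commutator_sym; exact: Zcomm.
  by rewrite /commutator catA -(rev_path_cat); exact: normal_cancel.
have Zw a w : Z (commutator (eval_letter a) (eval_word w)).
  elim: w => [|b w IH]; first by rewrite /commutator /= cats0; exact: normal_cancel.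
  rewrite -cat1s eval_word_cat; apply: commutator_cat => //.
  rewrite [eval_word [:: _]]cats0; case: a {IH} => i []; last exact: Zl.
  by apply/commutator_sym/commutator_rev/commutator_sym; exact: Zl.
have [k] := ubnP (size u); elim: k => // k IH in u *.
case: u => [|[i b] u] /=; first by case: nZ.
rewrite ltnS => uk u0.
have iu : (i, ~~ b) \in u.
  have := congr1 (fun n : 'rV_s => n 0 i) u0; rewrite !mxE /= !xpair_eqE !eqxx /=.
  by rewrite -has_pred1 has_count; case: b {uk u0} => /=; lia.
case/splitPr: iu uk u0 => u1 u2 uk u0.
have {}u0 : exponents (u1 ++ u2) = 0.
  rewrite -u0 -(cat1s (i, b)) -(cat1s (i, ~~ b)) !exponents_cat !exponents1.
  by case: b {uk u0} => /=; rewrite (addrC (exponents u1) (_ + _)) addrA ?addNr ?addrA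
    ?addrN ?addNr add0r addrC.
have {IH uk} Z12 : Z (eval_word (u1 ++ u2)).
  by apply: IH => //; rewrite (leq_trans _ uk)// !size_cat /= addnS.
set g := eval_letter (i, b).
have gV : eval_letter (i, ~~ b) = rev_path g.
  by rewrite /g /eval_letter; case: b {g u0} => /=; rewrite ?rev_pathK.
have -> : eval_word ((i, b) :: u1 ++ (i, ~~ b) :: u2) =
    g ++ eval_word u1 ++ rev_path g ++ eval_word u2.
  rewrite -(cat1s (i, b)) -(cat1s (i, ~~ b)) !eval_word_cat -gV.
  by rewrite [eval_word [:: (i, b)]]cats0 [eval_word [:: _]]cats0.
have [E1 _] := normal_ins (g ++ eval_word u1 ++ rev_path g) (eval_word u2)
  (normal_cancel_rev (eval_word u1)).
have [_ E2] := normal_ins [::] (eval_word u1 ++ eval_word u2) (Zw (i, b) u1).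
move: E1 E2; rewrite /commutator /= -!catA => E1 E2; apply/E1/E2.
by rewrite -eval_word_cat.
Qed.

End Words.
End NormalWords.

(** * Edge-paths and the cycles they carry *)

Section Paths.
Variable G : graph.
Implicit Types (u v w : vertex G) (x y : dart G) (p q : seq (dart G)).

Lemma is_path_cat u p q v :
  is_path u (p ++ q) v <-> exists w, is_path u p w /\ is_path w q v.
Proof.
elim: p u => [|x p IH] u /=.
  by split=> [H|[w [-> //]]]; exists u.
rewrite IH; split=> [[-> [w [Hp Hq]]]|[w [[-> Hp] Hq]]]; first by exists w.
by split=> //; exists w.
Qed.

Lemma is_path_rev u p v : is_path u p v -> is_path v (rev_path p) u.
Proof.
elim: p u => [|x p IH] u /=; first by move->.
move=> [<- /IH Hp]; rewrite rev_path_cons; apply/is_path_cat.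
by exists (tgt x); split=> //=; split=> //; rewrite /tgt invK.
Qed.

Lemma homotopic_cat u v w z p q a b : homotopic u v p q ->
  is_path w a u -> is_path v b z -> homotopic w z (a ++ p ++ b) (a ++ q ++ b).
Proof.
move=> + Ha Hb; elim=> {p q} [p Hp|p q _|p q r _ H1 _ H2|p x q Hpq].
- apply: HomotopicRefl; apply/is_path_cat; exists u; split=> //.
  by apply/is_path_cat; exists v.
- exact: HomotopicSym.
- exact: HomotopicTrans H1 H2.
- have := @HomotopicBacktrack G w z (a ++ p) x (q ++ b); rewrite -!catA; apply.
  apply/is_path_cat; exists u; split=> //.
  rewrite -!cat_cons catA; apply/is_path_cat; exists v; split=> //.
Qed.

Lemma homotopic_cancel u v p :
  is_path u p v -> homotopic u u (p ++ rev_path p) [::].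
Proof.
elim: p u => [|x p IH] u /=; first by move=> _; exact: HomotopicRefl.
move=> [xu Hp]; have Hx : is_path (tgt x) [:: inv x] u by rewrite /= /tgt invK.
have Hx' : is_path u [:: x] (tgt x) by [].
rewrite rev_path_cons catA -cat1s.
apply: HomotopicTrans (homotopic_cat (IH _ Hp) Hx' Hx) _ => /=.
by apply: (@HomotopicBacktrack _ u u [::] x [::]) => /=; rewrite /tgt invK.
Qed.

Definition dart_chain x : dart G -> int := fun z => (z == x)%:Z - (z == inv x)%:Z.

Definition path_chain p : dart G -> int := \sum_(x <- p) dart_chain x.

Lemma dart_chain_inv x : dart_chain (inv x) = - dart_chain x.
Proof. by apply/funext => z; rewrite /dart_chain invK /GRing.opp /= opprB. Qed.

Lemma path_chain_cat p q : path_chain (p ++ q) = path_chain p + path_chain q.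
Proof. by rewrite /path_chain big_cat. Qed.

Lemma path_chain_rev p : path_chain (rev_path p) = - path_chain p.
Proof.
rewrite /path_chain /rev_path big_rev big_map -sumrN.
by apply: eq_bigr => x _; exact: dart_chain_inv.
Qed.

Lemma path_chainE p z : path_chain p z = \sum_(x <- p) dart_chain x z.
Proof. by rewrite /path_chain fct_sumE. Qed.

Lemma path_chain_homotopic u v p q :
  homotopic u v p q -> path_chain p = path_chain q.
Proof.
elim=> {p q} // [p q r _ -> _ -> //|p x q _].
by rewrite !path_chain_cat /path_chain !big_cons dart_chain_inv addNKr.
Qed.

(** Applied to [path_chain], this bounds the size of generating sets from below;
    applied to the weights, which are onto T, it shows that the weights of any
    generating set of pi_1 generate T. *)
Lemma generates_pi1_subgroup (A : zmodType) (f : seq (dart G) -> A) v L p :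
  (forall p q, f (p ++ q) = f p + f q) -> (forall p, f (rev_path p) = - f p) ->
  (forall p q, homotopic v v p q -> f p = f q) ->
  generates_pi1 v L -> is_path v p v ->
  subgroup_gen [set f q | q in [set` L]] (f p).
Proof.
move=> fD fN fH [_ Lgen] /Lgen[ps psL /fH ->] {p}.
have sg := subgroup_gen_subgroup [set f q | q in [set` L]].
elim: ps psL => [|q ps IH] psL /=.
  have := fD [::] [::] => /= /eqP; rewrite -subr_eq0 opprD addNKr oppr_eq0.
  by move=> /eqP ->; case: sg.
rewrite fD; apply: (subgroupD sg); last first.
  by apply: IH => r rps; apply: psL; rewrite inE rps orbT.
have [qL|qL] := psL q (mem_head _ _); first by apply: mem_subgroup_gen; exists q.
rewrite -[q]rev_pathK fN; apply: (subgroupN sg).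
by apply: mem_subgroup_gen; exists (rev_path q).
Qed.

Lemma connected_paths u : connected_graph G ->
  exists f : vertex G -> seq (dart G), forall v, is_path u (f v) v.
Proof. by move=> hG; have [f fP] := choice (hG u); exists f. Qed.

End Paths.

Section Cycles.
Variable G : graph.
Implicit Types (u v w : vertex G) (x y : dart G) (p q : seq (dart G)).
Implicit Types (c : dart G -> int).

Lemma is_chain_subgroup : is_subgroup (@is_chain G).
Proof.
split.
  split=> [|x]; last by rewrite oppr0.
  by rewrite (_ : [set _ | _] = set0) // -subset0 => x /eqP; exact.
move=> c c' [fc cN] [fc' cN']; split=> [|x]; last first.
  by rewrite !fctE cN cN' opprD.
apply: (@sub_finite_set _ _ ([set x | c x != 0] `|` [set x | c' x != 0])); last first.
  by rewrite finite_setU.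
move=> x /=; apply: contra_neqP => /not_orP[/negP/negPn/eqP c0 /negP/negPn/eqP c0'].
by rewrite !fctE c0 c0' subrr.
Qed.

Lemma is_chain_dart x : is_chain (dart_chain x).
Proof.
split=> [|y]; last first.
  by rewrite /dart_chain (inv_eq (@invK G)) (can_eq (@invK G)) opprB.
apply: (@sub_finite_set _ _ [set x; inv x]); last exact: finite_set2.
move=> z /=; rewrite /dart_chain; have [->|_] := eqVneq z x; first by left.
by have [->|_] := eqVneq z (inv x); [right | rewrite subrr eqxx].
Qed.

Hypothesis lfG : locally_finite G.

Lemma finite_tgt v : finite_set [set x : dart G | tgt x = v].
Proof.
have -> : [set x : dart G | tgt x = v] = inv @` [set x : dart G | src x = v].
  apply/seteqP; split=> [x /= <-|_ [x /= <- <-]]; last by rewrite /tgt invK.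
  by exists (inv x); rewrite ?invK.
exact: finite_image (lfG v).
Qed.

Lemma boundaryE c v :
  boundary c v = \sum_(x <- fset_set [set x : dart G | tgt x = v]) c x.
Proof. by rewrite /boundary fsbig_finite//; exact: finite_tgt. Qed.

Lemma boundaryB c c' v : boundary (c - c') v = boundary c v - boundary c' v.
Proof. by rewrite !boundaryE -sumrB. Qed.

Lemma H1_subgroup : is_subgroup (H1 G).
Proof.
have [ch0 chB] := is_chain_subgroup; split.
  by split=> // v; rewrite /boundary fsbig1.
move=> c c' [cc c0] [cc' c0']; split; first exact: chB.
by move=> v; rewrite boundaryB c0 c0' subrr.
Qed.

Lemma boundary_dart x v :
  boundary (dart_chain x) v = (tgt x == v)%:Z - (src x == v)%:Z.
Proof.
have fin := finite_tgt v.
rewrite boundaryE sumrB; set F := fset_set _.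
have sum1 y : \sum_(z <- F) (z == y)%:Z = (tgt y == v)%:Z.
  have [yF|yF] := boolP (y \in F).
    rewrite (bigD1_seq y)//= eqxx big1 ?addr0 => [|z /negbTE -> //].
    by move: yF; rewrite in_fset_set// inE => /= ->; rewrite eqxx.
  rewrite big_seq big1 => [|z zF]; last by case: eqP zF yF => // -> ->.
  by move: yF; rewrite in_fset_set// notin_setE /= => /eqP/negbTE ->.
by rewrite !sum1 /tgt invK.
Qed.

Lemma boundary_path u p w v : is_path u p w ->
  boundary (path_chain p) v = (w == v)%:Z - (u == v)%:Z.
Proof.
elim: p u => [|x p IH] u /=.
  by move=> ->; rewrite /path_chain big_nil /boundary fsbig1// subrr.
move=> [<- /IH bp]; rewrite /path_chain big_cons -[dart_chain x]opprK addrC.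
rewrite boundaryB bp.
by rewrite -dart_chain_inv boundary_dart /tgt invK opprB addrA subrK.
Qed.

Lemma H1_loop u p : is_path u p u -> H1 G (path_chain p).
Proof.
move=> Hp; split; last by move=> v; rewrite (boundary_path _ Hp) subrr.
by apply: (subgroup_sum is_chain_subgroup) => x _; exact: is_chain_dart.
Qed.

End Cycles.

Section CyclesFromLoops.
Variable G : graph.
Implicit Types (u v w : vertex G) (x y : dart G) (p q : seq (dart G)).

(** One direction is chosen for each cell: [choose] depends on the set
    {x, inv x} only. *)
Definition positive x : bool := choose (pred2 x (inv x)) x == x.

Lemma positive_inv x : positive (inv x) = ~~ positive x.
Proof.
rewrite /positive invK.
have -> : choose (pred2 (inv x) x) (inv x) = choose (pred2 x (inv x)) x.
  rewrite (@eq_choose _ (pred2 (inv x) x) (pred2 x (inv x))) => [|z] /=.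
    by apply: choose_id; rewrite /= eqxx ?orbT.
  exact: orbC.
have : pred2 x (inv x) (choose (pred2 x (inv x)) x).
  by apply: chooseP; rewrite /= eqxx.
move=> /= /orP[] /eqP ->; rewrite eqxx ?(negbTE (inv_neq x)) //.
by rewrite eq_sym (negbTE (inv_neq x)).
Qed.

Lemma sum_positive (M : zmodType) (c : dart G -> int) (r : seq (dart G))
    (f : dart G -> M) :
  uniq r -> (forall x, (inv x \in r) = (x \in r)) ->
  (forall x, c (inv x) = - c x) ->
  \sum_(x <- r | positive x) (f x - f (inv x)) *~ c x = \sum_(x <- r) f x *~ c x.
Proof.
move=> ur rN cN; rewrite [RHS](bigID positive)/=.
have -> : \sum_(x <- r | ~~ positive x) f x *~ c x =
    \sum_(x <- r | positive x) f (inv x) *~ - c x.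
  rewrite (perm_big (map inv r)) /=; last first.
    apply: uniq_perm => //; first by rewrite map_inj_uniq//; exact: inv_inj (@invK G).
    move=> x; rewrite -[x in RHS]invK mem_map ?rN//; exact: inv_inj (@invK G).
  rewrite big_map; apply: eq_big => x; first by rewrite positive_inv negbK.
  by rewrite cN.
rewrite -big_split /=; apply: eq_bigr => x _.
by rewrite mulrzBl mulrNz.
Qed.

Lemma fct_mulrz (T : Type) (f : T -> int) (n : int) z : (f *~ n) z = f z * n.
Proof.
have nat_case k : (f *+ k) z = f z * k%:Z.
  elim: k => [|k IH]; first by rewrite mulr0n mulr0.
  by rewrite mulrS fctE IH intS mulrDr mulr1.
case: n => k; first exact: nat_case.
by rewrite NegzE mulrNz mulrN -nat_case.
Qed.

(** Replacing each cell of the support of a cycle by the loop that runs through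
    it from the base vertex along chosen paths changes the chain by a combination
    of those paths with the coefficients of the boundary, that is by 0. *)
Lemma H1_generated_by_loops u (H : set (dart G -> int)) :
  connected_graph G -> is_subgroup H ->
  (forall p, is_path u p u -> H (path_chain p)) -> H1 G `<=` H.
Proof.
move=> hG sgH Hloop c [[fc cN] bc0].
have [gam gamP] := connected_paths u hG.
pose X := fset_set [set x | c x != 0].
have XP x : (x \in X) = (c x != 0).
  by rewrite in_fset_set//; apply/idP/idP; rewrite inE.
have XN x : (inv x \in X) = (x \in X) by rewrite !XP cN oppr_eq0.
pose chi x : dart G -> int := fun z => (z == x)%:Z.
have cE : c = \sum_(x <- X | positive x) dart_chain x *~ c x.
  have cE0 : c = \sum_(x <- X) chi x *~ c x.
    apply/funext => z; rewrite fct_sumE.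
    have [zX|zX] := boolP (z \in X).
      rewrite (bigD1_seq z)//= big1 ?addr0 => [|x xz]; rewrite fct_mulrz /chi.
        by rewrite eqxx mul1r.
      by rewrite eq_sym (negbTE xz) mul0r.
    have := zX; rewrite XP negbK => /eqP ->.
    rewrite big_seq big1// => x xX; rewrite fct_mulrz /chi.
    by have [zx|_] := eqVneq z x; [rewrite zx xX in zX | rewrite mul0r].
  by rewrite [LHS]cE0 -(sum_positive chi (fset_uniq X) XN cN).
pose f x := path_chain (gam (tgt x)).
have f0 : \sum_(x <- X | positive x) (f x - f (inv x)) *~ c x = 0.
  rewrite (sum_positive f (fset_uniq X) XN cN); pose V := [fset tgt x | x in X]%fset.
  transitivity (\sum_(x <- X) \sum_(a <- V | tgt x == a) path_chain (gam a) *~ c x).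
    rewrite big_seq [RHS]big_seq; apply: eq_bigr => x xX.
    have xV : tgt x \in V by apply/imfsetP; exists x.
    rewrite big_mkcond (bigD1_seq (tgt x))//= eqxx big1 ?addr0// => a.
    by rewrite eq_sym => /negbTE ->.
  rewrite (exchange_big_dep predT)//= big1// => a _; rewrite -mulrz_sumr.
  suff <- : boundary c a = \sum_(x <- X | tgt x == a) c x by rewrite bc0 mulr0z.
  rewrite /boundary (fsbigE [seq x <- X | tgt x == a]).
  - rewrite big_filter_cond; apply: eq_bigl => x; rewrite andb_idr// => /eqP xa.
    exact: mem_set.
  - exact: filter_uniq.
  - by move=> x /=; rewrite mem_filter => /andP[/eqP].
  - move=> x /= xa; rewrite mem_filter xa eqxx /= XP negbK; exact: eqP.
suff : H (\sum_(x <- X | positive x) (dart_chain x - (f x - f (inv x))) *~ c x).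
  by under eq_bigr do rewrite mulrzBl; rewrite sumrB f0 subr0 -cE.
apply: (subgroup_sum sgH) => x _; apply: (subgroupMz sgH).
rewrite opprB addrA.
have -> : dart_chain x + f (inv x) - f x =
    path_chain (gam (src x) ++ [:: x] ++ rev_path (gam (tgt x))).
  rewrite !path_chain_cat path_chain_rev {2}/path_chain big_seq1 /f /tgt invK.
  by rewrite -addrA addrCA.
apply: Hloop; apply/is_path_cat; exists (src x); split=> //=.
by split=> //; exact: is_path_rev.
Qed.

End CyclesFromLoops.

(** * Spanning trees and the rank of the fundamental group *)

(** A breadth-first tree: [par u] is the last dart of a shortest path from the
    root [v] to [u]. The distance to the root increases by one along [par u],
    hence no edge of the tree is chosen by both of its ends. *)
Lemma spanning_tree (G : graph) (x0 : dart G) (v : vertex G) :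
  connected_graph G ->
  exists (par : vertex G -> dart G) (gam : vertex G -> seq (dart G)),
  [/\ gam v = [::],
      (forall u, is_path v (gam u) u),
      (forall u, u <> v -> tgt (par u) = u /\
                           gam u = gam (src (par u)) ++ [:: par u]),
      (forall u y, y \in gam u -> exists2 w, w <> v & y = par w) &
      (forall u w, u <> v -> w <> v -> par u <> inv (par w))].
Proof.
move=> hG.
have [dist distP] : exists dist : vertex G -> nat, forall u,
    is_min [set n | exists2 p, is_path v p u & size p = n] (dist u).
  suff /choice[f fP] : forall u, exists m,
      is_min [set n | exists2 p, is_path v p u & size p = n] m by exists f.
  by move=> u; have [p Hp] := hG v u; apply: (@is_min_exists _ (size p)); exists p.
have dist_le u p : is_path v p u -> (dist u <= size p)%N.
  by move=> Hp; have [_ ->//] := distP u; exists p.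
have [par parP] : exists par : vertex G -> dart G, forall u, u <> v ->
    tgt (par u) = u /\ dist u = (dist (src (par u))).+1.
  suff /choice[f fP] : forall u, exists x, u <> v ->
      tgt x = u /\ dist u = (dist (src x)).+1 by exists f.
  move=> u; have [|uv] := pselect (u = v); first by exists x0.
  have [[p + sp] _] := distP u.
  case: (lastP p) sp => [_ /= uv'|p' x sp]; first by rewrite uv' in uv.
  rewrite -cats1 => /is_path_cat[w [Hp' /= [xw xu]]]; exists x => _; split=> //.
  have [[q Hq sq] _] := distP (src x).
  apply/eqP; rewrite eqn_leq; apply/andP; split.
    rewrite -sq -(size_rcons q x) dist_le// -cats1.
    by apply/is_path_cat; exists (src x).
  by rewrite -sp size_rcons ltnS dist_le// xw.
pose fix g (n : nat) (u : vertex G) {struct n} : seq (dart G) :=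
  if n is n'.+1 then g n' (src (par u)) ++ [:: par u] else [::].
pose gam u := g (dist u) u.
have dv : dist v = 0%N by apply/eqP; rewrite -leqn0 (dist_le v [::]).
have gamS u : u <> v -> gam u = gam (src (par u)) ++ [:: par u].
  by move=> uv; rewrite {1}/gam; have [_ ->] := parP u uv.
have gamv : gam v = [::] by rewrite /gam dv.
exists par, gam; split=> //.
- move=> u; have [n] := ubnP (dist u); elim: n => // n IH in u *.
  have [->|uv] := pselect (u = v); first by rewrite gamv.
  have [pu du] := parP u uv; rewrite gamS// du ltnS => dn.
  by apply/is_path_cat; exists (src (par u)); split; [exact: IH | split].
- by move=> u uv; split; [case: (parP u uv) | exact: gamS].
- move=> u y; have [n] := ubnP (dist u); elim: n => // n IH in u *.
  have [->|uv] := pselect (u = v); first by rewrite gamv.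
  have [pu du] := parP u uv; rewrite gamS// du ltnS => dn.
  by rewrite mem_cat => /orP[/IH|]; [apply | rewrite inE => /eqP ->; exists u].
- move=> u w uv wv uw; have [pu du] := parP u uv; have [pw dw] := parP w wv.
  have uE : u = src (par w) by rewrite -pu uw /tgt invK.
  have wE : w = src (par u) by rewrite -pw uw.
  by move: du dw; rewrite -uE -wE; lia.
Qed.

Section SpanningTree.
Variables (G : graph) (v : vertex G).
Variables (par : vertex G -> dart G) (gam : vertex G -> seq (dart G)).
Hypothesis gamv : gam v = [::].
Hypothesis gamP : forall u, is_path v (gam u) u.
Hypothesis gamS : forall u, u <> v ->
  tgt (par u) = u /\ gam u = gam (src (par u)) ++ [:: par u].
Hypothesis gam_par : forall u y, y \in gam u -> exists2 w, w <> v & y = par w.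
Hypothesis par_inv : forall u w, u <> v -> w <> v -> par u <> inv (par w).
Implicit Types (x y : dart G).

Definition tree_dart y : Prop :=
  exists2 w, w <> v & y = par w \/ y = inv (par w).

Definition tree_loop y := gam (src y) ++ y :: rev_path (gam (tgt y)).

Lemma tree_loop_path y : is_path v (tree_loop y) v.
Proof.
apply/is_path_cat; exists (src y); split=> //=; split=> //.
exact: is_path_rev.
Qed.

Lemma tree_loop_inv y : rev_path (tree_loop y) = tree_loop (inv y).
Proof.
by rewrite /tree_loop rev_path_cat rev_path_cons rev_pathK /tgt invK -catA.
Qed.

Lemma tree_loop_tree y : tree_dart y -> homotopic v v (tree_loop y) [::].
Proof.
move=> [w wv [] ->]; have [wE gE] := gamS wv; rewrite /tree_loop.
  rewrite wE -cat1s catA -gE; exact: homotopic_cancel (gamP w).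
set y' := src (par w); rewrite -[src (inv _)]/(tgt (par w)) wE gE.
rewrite [tgt (inv _)]/tgt invK -/y' -catA /=.
apply: HomotopicTrans (homotopic_cancel (gamP y')).
apply: HomotopicBacktrack; apply/is_path_cat; exists y'; split=> //=.
by split=> //; split=> //; rewrite /tgt invK; exact: is_path_rev.
Qed.

(** Inserting at each vertex of an edge-path the way to the root and back writes
    the path as a product of loops [tree_loop y], those along the tree being
    trivial. *)
Lemma path_tree_loops u p w : is_path u p w ->
  exists2 ps, (forall q, q \in ps -> exists2 y, ~ tree_dart y & q = tree_loop y) &
    homotopic v v (gam u ++ p ++ rev_path (gam w)) (flatten ps).
Proof.
elim: p u => [|x p IH] u /=.
  by move=> ->; exists [::] => //; exact: homotopic_cancel (gamP w).
move=> [<- Hp]; have [ps psP ps_h] := IH _ Hp.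
set t := tgt x in Hp ps_h *.
have Htp : is_path t (p ++ rev_path (gam w)) v.
  by apply/is_path_cat; exists w; split=> //; exact: is_path_rev.
have Hx : is_path v (gam (src x) ++ [:: x]) t.
  by apply/is_path_cat; exists (src x).
have ins : homotopic v v (gam (src x) ++ x :: p ++ rev_path (gam w))
    (tree_loop x ++ gam t ++ p ++ rev_path (gam w)).
  have := homotopic_cancel (is_path_rev (gamP t)); rewrite rev_pathK => H.
  have := homotopic_cat H Hx Htp.
  by rewrite /tree_loop -!catA /= => /HomotopicSym.
have [tx|tx] := pselect (tree_dart x).
  exists ps => //; apply: HomotopicTrans ins _; apply: HomotopicTrans ps_h.
  have Hv : is_path v [::] v by [].
  apply: (homotopic_cat (tree_loop_tree tx) Hv (b := _)).
  by apply/is_path_cat; exists t.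
exists (tree_loop x :: ps) => [q|/=].
  by rewrite inE => /orP[/eqP ->|/psP//]; exists x.
apply: HomotopicTrans ins _.
have Hv : is_path v [::] v by [].
have := homotopic_cat ps_h (tree_loop_path x) Hv.
by rewrite !cats0.
Qed.

Lemma tree_loops_generate (xs : seq (dart G)) :
  (forall y, ~ tree_dart y -> y \in xs \/ inv y \in xs) ->
  generates_pi1 v (map tree_loop xs).
Proof.
move=> xsP; split=> [_ /mapP[y _ ->]|p /path_tree_loops[ps psP]].
  exact: tree_loop_path.
rewrite gamv cats0 /= => ps_h; exists ps => // q /psP[y /xsP yxs ->].
rewrite tree_loop_inv.
by case: yxs => yxs; [left | right]; apply: map_f.
Qed.

(** The detours to the root run inside the tree, hence miss [y]. *)
Lemma tree_loop_chain x y : ~ tree_dart y -> y <> inv x ->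
  path_chain (tree_loop x) y = (y == x)%:Z.
Proof.
move=> ty /eqP/negbTE yx; rewrite /tree_loop -cat1s !path_chain_cat path_chain_rev.
have gam0 u : path_chain (gam u) y = 0.
  rewrite path_chainE big_seq big1// => z /gam_par[w wv ->]; rewrite /dart_chain.
  have [yw|_] := eqVneq y (par w); first by case: ty; exists w => //; left.
  by have [yw|_] := eqVneq y (inv (par w)); first by case: ty; exists w => //; right.
rewrite !fctE !gam0 oppr0 addr0 add0r path_chainE big_seq1 /dart_chain yx.
by rewrite subr0.
Qed.

(** The loops of the edges off the tree are dual to these edges, so they remain
    linearly independent in H_1 and any generating set is at least as large. *)
Lemma tree_loops_minimal (xs : seq (dart G)) (L : seq (seq (dart G))) :
  uniq xs -> (forall x, x \in xs -> ~ tree_dart x) ->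
  (forall x, x \in xs -> inv x \notin xs) ->
  generates_pi1 v L -> (size xs <= size L)%N.
Proof.
move=> uxs txs Nxs Lgen.
have [[x0 _]|xs0] := pselect (exists x : dart G, True); last first.
  by case: xs {uxs txs Nxs} xs0 => // x xs xs0; case: xs0; exists x.
pose r := map (@path_chain G) L.
have coef (i : 'I_(size xs)) : exists n : 'rV[int]_(size r),
    path_chain (tree_loop (nth x0 xs i)) = \sum_(k < size r) r`_k *~ n 0 k.
  have sub := generates_pi1_subgroup (@path_chain_cat G) (@path_chain_rev G)
    (@path_chain_homotopic G v v) Lgen (tree_loop_path (nth x0 xs i)).
  apply: subgroup_gen_coef sub => _ [q qL <-].
  exact: (map_f (@path_chain G) qL).
have [n nP] := choice coef.
(* The identity matrix factors through Z^(size L). *)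
have AB : (\matrix_(i, k) n i 0 k) *m
    (\matrix_(k < size r, j < size xs) r`_k (nth x0 xs j)) = 1%:M.
  apply/matrixP => i j; rewrite !mxE.
  have xj : nth x0 xs j \in xs by rewrite mem_nth.
  transitivity (path_chain (tree_loop (nth x0 xs i)) (nth x0 xs j)).
    rewrite nP fct_sumE; apply: eq_bigr => k _.
    by rewrite fct_mulrz !mxE mulrC.
  rewrite tree_loop_chain; last 2 first.
  - exact: txs.
  - move=> xij; have /Nxs : nth x0 xs i \in xs by rewrite mem_nth.
    by rewrite -xij xj.
  by rewrite nth_uniq// -val_eqE eq_sym; case: (_ == _).
by have := mulmx1_min AB; rewrite size_map.
Qed.

(** Each vertex other than the root owns one edge of the tree, so the tree has
    [nu - 1] edges; one dart is picked from each of the other edges. *)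
Lemma off_tree_darts (nu eps : nat) :
  [set: vertex G] #= `I_nu -> edges G #= `I_eps ->
  exists xs : seq (dart G), [/\ (size xs + nu = eps.+1)%N, uniq xs,
    (forall y, ~ tree_dart y -> y \in xs \/ inv y \in xs),
    (forall x, x \in xs -> ~ tree_dart x) &
    (forall x, x \in xs -> inv x \notin xs)].
Proof.
move=> hnu heps; pose edge x : set (dart G) := [set x; inv x].
have edgeP x y : edge x = edge y -> x = y \/ x = inv y.
  by move=> xy; have : edge y x by rewrite -xy; left.
have edge_inv x : edge (inv x) = edge x.
  by rewrite /edge invK; apply/seteqP; split=> z /= [|]; by [left|right].
have Vfin : finite_set [set: vertex G] by apply/finite_setP; exists nu.
have Efin : finite_set (edges G) by apply/finite_setP; exists eps.
pose V := fset_set [set: vertex G]; pose E := fset_set (edges G).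
have VE u : u \in V by rewrite in_fset_set// inE.
have EE x : edge x \in E by rewrite in_fset_set// inE; exists x.
pose T := [fset edge (par u) | u in (V `\ v)%fset]%fset.
have Vv u : (u \in (V `\ v)%fset) <-> u <> v.
  by rewrite in_fsetD1 VE andbT; split=> /eqP.
have edgeT x : (edge x \in T) <-> tree_dart x.
  split=> [/imfsetP[u /= /Vv uv /edgeP xu]|[u uv xu]]; first by exists u.
  apply/imfsetP; exists u; first exact/Vv.
  by case: xu => ->; rewrite ?edge_inv.
have cardT : (#|` T| + 1 = nu)%N.
  rewrite card_in_imfset /=; last first.
    move=> u w /Vv uv /Vv wv /edgeP[uw|/(par_inv uv wv) []].
    by have [<- _] := gamS uv; have [<- _] := gamS wv; rewrite uw.
  by have := cardfsD1 v V; rewrite VE (card_fset_set hnu) addnC => ->.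
have TE : (T `<=` E)%fset by apply/fsubsetP => _ /imfsetP[u _ ->].
have [[x0 _]|nodart] := pselect (exists x : dart G, True); last first.
  exists [::]; split=> //=; first last.
    by move=> y; case: nodart; exists y.
  have T0 : T = fset0.
    apply/fsetP => e; rewrite in_fset0; apply/imfsetP => -[u].
    by case: nodart; exists (par u).
  have E0 : E = fset0.
    apply/fsetP => e; rewrite in_fset0; apply/negP; rewrite in_fset_set// inE => -[x].
    by case: nodart; exists x.
  by rewrite -cardT T0 -(card_fset_set heps) -/E E0 !cardfs0.
have /choice[pick pickP] : forall e, exists x, edges G e -> edge x = e.
  by move=> e; have [[x _ <-]|] := pselect (edges G e); [exists x | exists x0].
have pickE e : e \in E -> edge (pick e) = e by rewrite in_fset_set// inE => /pickP.
have NE e : e \in (E `\` T)%fset -> e \in E /\ e \notin T.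
  by rewrite in_fsetD => /andP[].
exists (map pick (E `\` T)%fset); split.
- rewrite size_map -(card_fset_set heps) -/E -cardT -(cardfsID T E).
  by rewrite (fsetIidPr TE) addnA addn1 addnC.
- rewrite map_inj_in_uniq ?fset_uniq// => e e' /NE[eE _] /NE[e'E _] ee'.
  by rewrite -(pickE e eE) -(pickE e' e'E) ee'.
- move=> y ty; have yN : edge y \in (E `\` T)%fset.
    by rewrite in_fsetD EE andbT; apply/negP => /edgeT.
  have := pickE _ (EE y) => /edgeP[] yE; [left | right].
    by apply/mapP; exists (edge y).
  by apply/mapP; exists (edge y); rewrite // yE.
- move=> _ /mapP[e /NE[eE eT] ->] /edgeT; rewrite pickE//.
  by move/negP: eT.
- move=> _ /mapP[e /NE[eE eT] ->]; apply/negP => /mapP[e' /NE[e'E _] pe].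
  have ee' : e = e' by rewrite -(pickE e eE) -(pickE e' e'E) -pe edge_inv.
  by move: (inv_neq (pick e)); rewrite pe ee' eqxx.
Qed.

End SpanningTree.

Lemma pi1_rank (G : graph) (v : vertex G) (nu eps g : nat) :
  connected_graph G -> [set: vertex G] #= `I_nu -> edges G #= `I_eps ->
  eps%:Z - nu%:Z + 1 = g%:Z -> (0 < g)%N ->
  exists2 L, minimal_generating_pi1 v L & size L = g.
Proof.
move=> hG hnu heps hg g0.
have [x0 _] : exists x : dart G, True.
  apply: contrapT => nodart.
  have E0 : edges G = set0.
    by rewrite -subset0 => e [x]; case: nodart; exists x.
  have V0 : fset_set [set: vertex G] != fset0.
    apply/fset0Pn; exists v; rewrite in_fset_set ?inE//.
    by apply/finite_setP; exists nu.
  have := card_fset_set heps; rewrite E0 fset_set0 cardfs0.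
  by move: V0; rewrite -cardfs_gt0 (card_fset_set hnu); lia.
have [par [gam [gamv gamP gamS gam_par par_inv]]] := spanning_tree x0 v hG.
have [xs [sxs uxs xsall xstree xsinv]] := off_tree_darts gamS par_inv hnu heps.
exists (map (tree_loop gam) xs); last by rewrite size_map; lia.
split; first exact: (tree_loops_generate gamv gamP gamS xsall).
by move=> L /(tree_loops_minimal gamP gam_par uxs xstree xsinv); rewrite size_map.
Qed.

(** * The kernel of a homomorphism from the fundamental group to Z^d *)

Lemma generators_right_inverse (d : nat) (r : seq 'rV[int]_d) :
  subgroup_gen [set` r] = setT ->
  exists A : 'M[int]_(d, size r), A *m (\matrix_(k < size r) r`_k) = 1%:M.
Proof.
move=> rgen; have coef (j : 'I_d) : exists n : 'rV[int]_(size r),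
    delta_mx 0 j = \sum_(k < size r) r`_k *~ n 0 k.
  by apply: (@subgroup_gen_coef _ r [set` r]) => //; rewrite rgen.
have [n nP] := choice coef; exists (\matrix_(j < d) n j).
apply/row_matrixP => j; rewrite row_mul rowK row1 nP row_mulmxE.
by apply: eq_bigr => k _; rewrite rowK.
Qed.

Section Kernel.
Variables (G : graph) (v : vertex G) (d : nat) (w : seq (dart G) -> 'rV[int]_d).
Hypothesis wD : forall p q, w (p ++ q) = w p + w q.
Hypothesis wN : forall p, w (rev_path p) = - w p.
Hypothesis wH : forall p q, homotopic v v p q -> w p = w q.
Implicit Types p q : seq (dart G).

Lemma hom_nil : w [::] = 0.
Proof.
have /eqP := wD [::] [::].
by rewrite -subr_eq0 opprD addNKr oppr_eq0 => /eqP.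
Qed.

Lemma hom_commutator p q : w (commutator p q) = 0.
Proof. by rewrite /commutator !wD !wN addrA addrACA !subrr addr0. Qed.

Lemma hom_eval_word s (ell : 'I_s -> seq (dart G)) u :
  w (eval_word ell u) = exponents u *m (\matrix_(k < s) w (ell k)).
Proof.
elim: u => [|[i b] u IH]; first by rewrite hom_nil exponents_nil mul0mx.
rewrite -cat1s eval_word_cat exponents_cat wD mulmxDl IH; congr +%R.
rewrite exponents1 [eval_word _ _]cats0 /eval_letter /=.
by case: b; rewrite ?wN ?mulNmx -rowE rowK.
Qed.

Lemma eval_word_path s (ell : 'I_s -> seq (dart G)) u :
  (forall i, is_path v (ell i) v) -> is_path v (eval_word ell u) v.
Proof.
move=> ellP; elim: u => // -[i b] u IH.
rewrite -cat1s eval_word_cat; apply/is_path_cat; exists v; split=> //.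
by rewrite [eval_word _ _]cats0 /eval_letter; case: b => //=; exact: is_path_rev.
Qed.

Lemma commutator_path p q :
  is_path v p v -> is_path v q v -> is_path v (commutator p q) v.
Proof.
move=> Hp Hq; do 3?[apply/is_path_cat; exists v; split=> //]; exact: is_path_rev.
Qed.

(** If the loops of [L1] already map onto generators of Z^d, the kernel is the
    normal closure of three families: each remaining generator times a word in
    [L1] with the opposite image, the commutators of loops of [L1], and words
    whose exponents span the relations between the images of [L1], a free abelian
    group of rank [size L1 - d]. Modulo these, every loop is a word in [L1] that
    depends on its exponents only. *)
Lemma kernel_normal_generators (L L1 L2 : seq (seq (dart G))) :
  generates_pi1 v L -> perm_eq L (L1 ++ L2) ->
  subgroup_gen [set` map w L1] = setT ->
  exists rs : seq (seq (dart G)),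
  [/\ size rs = (size L - d + 'C(size L1, 2))%N,
      (forall p, p \in rs -> is_path v p v /\ w p = 0) &
      (forall Z, normal_words Z -> (forall p, p \in rs -> Z p) ->
        forall p, is_path v p v -> w p = 0 -> Z p)].
Proof.
move=> [Lpath Lgen] LE /generators_right_inverse[].
set s := size (map w L1) => A AW.
have sE : s = size L1 by rewrite /s size_map.
have L12 p : (p \in L) = (p \in L1) || (p \in L2) by rewrite (perm_mem LE) mem_cat.
pose ell (k : 'I_s) := nth [::] L1 k.
have ellL1 k : ell k \in L1 by rewrite mem_nth// -sE.
have ellP k : is_path v (ell k) v by apply: Lpath; rewrite L12 ellL1.
set W := (X in _ *m X) in AW.
have WE : W = \matrix_(k < s) w (ell k).
  by apply/row_matrixP => k; rewrite !rowK (nth_map [::])// -sE.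
have ds : (d <= s)%N := mulmx1_min AW.
have [C CW Ckernel] := kermx_int_gen AW.
have [word wordE] := choice (@exponents_surj s).
have w_word n : w (eval_word ell (word n)) = n *m W.
  by rewrite hom_eval_word wordE WE.
have [js js_size js_all] : exists2 js : seq 'I_(s - d),
    size js = (s - d)%N & forall j, j \in js.
  by exists (enum 'I_(s - d)); [exact: size_enum_ord | move=> j; rewrite mem_enum].
pose rest p := p ++ rev_path (eval_word ell (word (w p *m A))).
pose ell' k := nth [::] L1 k.
pose rs := [seq rest p | p <- L2] ++
  [seq eval_word ell (word (row j C)) | j <- js] ++
  [seq commutator (ell' ij.1) (ell' ij.2) |
     ij <- [seq (i, j) | j <- iota 0 s, i <- iota 0 j]].
exists rs; split.
- rewrite !size_cat !size_map js_size size_ltn_pairs (perm_size LE) size_cat.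
  by rewrite addnA -sE (addnC s) addnBA.
- move=> p; rewrite !mem_cat => /or3P[] /mapP.
  + move=> [q qL2 ->]; split; last first.
      by rewrite wD wN w_word -mulmxA AW mulmx1 subrr.
    apply/is_path_cat; exists v; split; first by apply: Lpath; rewrite L12 qL2 orbT.
    exact/is_path_rev/eval_word_path.
  + move=> [j _ ->]; split; first exact: eval_word_path.
    by rewrite w_word -row_mul CW row0.
  + move=> [[i j] /allpairsPdep[j' [i' [+ + [-> ->]]]] ->] /=.
    rewrite !mem_iota /= !add0n => lt_js ij; split; last exact: hom_commutator.
    by apply: commutator_path; [exact: (ellP (Ordinal (ltn_trans ij lt_js)))
                              | exact: (ellP (Ordinal lt_js))].
- move=> Z nZ Zrs.
  have Zcomm (i j : 'I_s) : (i < j)%N -> Z (commutator (ell i) (ell j)).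
    move=> ij; apply: Zrs; rewrite !mem_cat; apply/or3P/Or33.
    apply/mapP; exists (i : nat, j : nat) => //.
    apply/allpairsPdep; exists (j : nat), (i : nat).
    by rewrite !mem_iota !add0n ij ltn_ord.
  have Z0 u : exponents u = 0 -> Z (eval_word ell u) by exact: normal_exponents0.
  (* A word of weight 0 has the same exponents as a product of the relators
     [word (row j C)] and their inverses. *)
  have Zker u : w (eval_word ell u) = 0 -> Z (eval_word ell u).
    rewrite hom_eval_word -WE => /Ckernel[a uE].
    have sg : is_subgroup [set n | exists2 u, exponents u = n & Z (eval_word ell u)].
      apply: exponents_subgroup; first by case: nZ.
      move=> u1 u2 Z1 Z2; rewrite eval_word_cat eval_inv_word.
      by apply/(normal_cat nZ) => //; exact: normal_rev.
    have [u' u'E Zu'] :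
        [set n | exists2 u, exponents u = n & Z (eval_word ell u)] (exponents u).
      rewrite uE row_mulmxE; apply: (subgroup_sum sg) => j _.
      apply: (subgroupMz sg); exists (word (row j C)); first exact: wordE.
      apply: Zrs; rewrite !mem_cat; apply/or3P/Or32.
      by apply: (map_f (fun j => eval_word ell (word (row j C)))).
    have := Z0 (u ++ inv_word u').
    rewrite exponents_cat exponents_inv u'E subrr => /(_ erefl).
    rewrite eval_word_cat eval_inv_word => /(normal_cat nZ); apply.
    exact: normal_rev.
  have gen q : q \in L -> exists2 u, Z (q ++ rev_path (eval_word ell u)) &
      w q = w (eval_word ell u).
    rewrite L12 => /orP[qL1|qL2].
      have qs : (index q L1 < s)%N by rewrite sE index_mem.
      exists [:: (Ordinal qs, false)];
        rewrite [eval_word _ _]cats0 /eval_letter /= /ell nth_index//.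
      exact: normal_cancel.
    exists (word (w q *m A)); last by rewrite w_word -mulmxA AW mulmx1.
    by apply: Zrs; rewrite mem_cat; apply/orP; left; exact: (map_f rest).
  have gen' q : q \in L \/ rev_path q \in L ->
      exists2 u, Z (q ++ rev_path (eval_word ell u)) & w q = w (eval_word ell u).
    move=> [/gen//|/gen[u Zu wu]]; exists (inv_word u); last first.
      by rewrite eval_inv_word wN -wu wN opprK.
    rewrite eval_inv_word rev_pathK.
    have := normal_rev nZ Zu; rewrite rev_path_cat !rev_pathK => /(normal_conj nZ q).
    by rewrite -!catA catA => /(normal_cat nZ); apply; exact: normal_cancel.
  have gens ps : (forall q, q \in ps -> q \in L \/ rev_path q \in L) ->
      exists2 u, Z (flatten ps ++ rev_path (eval_word ell u)) &
        w (flatten ps) = w (eval_word ell u).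
    elim: ps => [|q ps IH] psL; first by exists [::] => //; case: nZ.
    have [q' q'ps|u2 Z2 w2] := IH; first by apply: psL; rewrite inE q'ps orbT.
    have [u1 Z1 w1] := gen' q (psL q (mem_head _ _)).
    exists (u1 ++ u2); last by rewrite eval_word_cat !wD w1 w2.
    rewrite eval_word_cat rev_path_cat /= -catA (catA (flatten ps)).
    exact/(normal_ins nZ).
  move=> p /Lgen[ps /gens[u Zu wu] p_ps] wp.
  apply/(normal_homotopic nZ p_ps).
  move: Zu => /(normal_cat nZ); apply; apply: (normal_rev nZ); apply: Zker.
  by rewrite -wu -(wH p_ps).
Qed.

End Kernel.

(** * Lifting edge-paths to the periodic graph *)

Section Lift.
Variables (R : realType) (d l : nat) (K : periodic_graph R d l).
Variable vtilde : vertex (quotient_graph K) -> vertex K.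
Hypothesis vtildeK : representatives vtilde.
Local Notation G := (quotient_graph K).
Local Notation T := 'rV[int]_d.
Local Notation w := (path_weight vtilde).
Implicit Types (t : T) (y : dart G) (p q : seq (dart G)) (u : vertex G).

(** [qlift y] is an arbitrary lift. Correcting it by the shift of its origin gives
    the lift that starts in the translate by [t] of the representatives. *)
Definition lift_dart t y : dart K :=
  actd (t - vshift vtilde (src (qlift y))) (qlift y).

Fixpoint lift_path t p : seq (dart K) :=
  if p is y :: p' then lift_dart t y :: lift_path (t + weight vtilde y) p'
  else [::].

Lemma lift_dart_act t t' y : lift_dart (t + t') y = actd t (lift_dart t' y).
Proof. by rewrite /lift_dart -actdD addrA. Qed.

Lemma qd_lift_dart t y : qd (lift_dart t y) = y.
Proof. by rewrite -[RHS]qliftK; apply/esym/qdP; eexists. Qed.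

Lemma src_lift_dart t y : src (lift_dart t y) = act t (vtilde (src y)).
Proof.
rewrite /lift_dart actd_src.
have /(vshiftP vtildeK) aE : vshift vtilde (src (qlift y)) =
  vshift vtilde (src (qlift y)) by [].
by rewrite {2}aE -actD subrK.
Qed.

Lemma vshift_vtilde u t : vshift vtilde (act t (vtilde u)) = t.
Proof.
rewrite vshift_act// (_ : vshift _ _ = 0) ?addr0//.
by apply/(vshiftP vtildeK); rewrite act0 vtildeK.
Qed.

Lemma vshift_vtilde0 u : vshift vtilde (vtilde u) = 0.
Proof. by rewrite -[vtilde u]act0 vshift_vtilde. Qed.

Lemma lift_dart_qd (x : dart K) :
  lift_dart (vshift vtilde (src x)) (qd x) = x.
Proof.
have /qdP[t] := esym (qliftK (qd x)).
rewrite /lift_dart; move: (qlift (qd x)) => z ->.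
by rewrite actd_src vshift_act// -actdD opprD addrCA subrr addr0 addNr actd0.
Qed.

Lemma inv_lift_dart t y :
  inv (lift_dart t y) = lift_dart (t + weight vtilde y) (inv y).
Proof.
rewrite -[LHS]lift_dart_qd; congr lift_dart; last first.
  by rewrite -[in RHS](qd_lift_dart t y) [RHS]qinvE.
rewrite -[in RHS](qd_lift_dart t y) weightE// src_lift_dart vshift_vtilde.
by rewrite addrC subrK.
Qed.

Lemma path_weight_cons y p : w (y :: p) = weight vtilde y + w p.
Proof. by rewrite /path_weight big_cons. Qed.

Lemma path_weight_nil : w [::] = 0.
Proof. by rewrite /path_weight big_nil. Qed.

Lemma lift_path_cat t p q :
  lift_path t (p ++ q) = lift_path t p ++ lift_path (t + w p) q.
Proof.
elim: p t => [|y p IH] t /=; first by rewrite path_weight_nil addr0.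
by rewrite IH path_weight_cons (addrA t (weight vtilde y)).
Qed.

Lemma lift_path_act t t' p : lift_path (t + t') p = map (actd t) (lift_path t' p).
Proof. by elim: p t' => //= y p IH t'; rewrite lift_dart_act -addrA IH. Qed.

Lemma lift_pathP t u p u' : is_path u p u' ->
  is_path (act t (vtilde u)) (lift_path t p) (act (t + w p) (vtilde u')).
Proof.
elim: p t u => [|y p IH] t u /=; first by move=> ->; rewrite path_weight_nil addr0.
move=> [<- /(IH (t + weight vtilde y)) Hp]; split; first exact: src_lift_dart.
rewrite /tgt inv_lift_dart src_lift_dart.
by rewrite path_weight_cons (addrA t (weight vtilde y)).
Qed.

Lemma project_path (p : seq (dart K)) a b : is_path a p b ->
  [/\ is_path (qv a : vertex G) (map (@qd _ _ _ K) p) (qv b),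
      lift_path (vshift vtilde a) (map (@qd _ _ _ K) p) = p &
      w (map (@qd _ _ _ K) p) = vshift vtilde b - vshift vtilde a].
Proof.
elim: p a => [|x p IH] a /=.
  by move=> ->; split=> //; rewrite path_weight_nil subrr.
move=> [<- /IH[Hp liftp wp]]; split.
- split; first exact: qsrcE.
  by rewrite qinvE qsrcE; exact: Hp.
- by rewrite lift_dart_qd weightE// addrC subrK liftp.
- by rewrite path_weight_cons wp weightE// addrC addrA subrK.
Qed.

Lemma quotient_connected : connected_graph K -> connected_graph G.
Proof.
move=> hK u u'; have [p /project_path[Hp _ _]] := hK (vtilde u) (vtilde u').
by move: Hp; rewrite !vtildeK; exists (map (@qd _ _ _ K) p).
Qed.

Lemma path_weight_surj u t : connected_graph K ->
  exists2 p, is_path u p u & w p = t.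
Proof.
move=> hK; have [p Hp] := hK (vtilde u) (act t (vtilde u)).
have [Hq _ wq] := project_path Hp; exists (map (@qd _ _ _ K) p).
  have qu : qv (act t (vtilde u)) = u.
    by rewrite -[RHS]vtildeK; apply/esym/qvP; exists t.
  by move: Hq; rewrite qu vtildeK.
by rewrite wq vshift_vtilde vshift_vtilde0 subr0.
Qed.

Lemma translate0 (c : dart K -> int) : translate 0 c = c.
Proof. by apply/funext => x; rewrite /translate oppr0 actd0. Qed.

Lemma translateD t t' (c : dart K -> int) :
  translate t (translate t' c) = translate (t + t') c.
Proof. by apply/funext => x; rewrite /translate -actdD opprD addrC. Qed.

Lemma translate_path_chain t (p : seq (dart K)) :
  translate t (path_chain p) = path_chain (map (actd t) p).
Proof.
apply/funext => x; rewrite /translate !path_chainE big_map.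
have actdE (a b : dart K) : (actd (- t) a == b) = (a == actd t b).
  by apply/eqP/eqP => [<-|->]; rewrite -actdD ?subrr ?addNr actd0.
by apply: eq_bigr => a _; rewrite /dart_chain !actdE actd_inv.
Qed.

Definition lift_chain p : dart K -> int := path_chain (lift_path 0 p).

(** [lift_chain] is a crossed homomorphism, since the lift of [q] starts where that
    of [p] ends, in the translate by [w p]. *)
Lemma lift_chain_cat p q :
  lift_chain (p ++ q) = lift_chain p + translate (w p) (lift_chain q).
Proof.
rewrite /lift_chain lift_path_cat path_chain_cat translate_path_chain.
by rewrite -lift_path_act addr0 add0r.
Qed.

(** On sequences of weight 0 the crossed homomorphism is additive, and conjugating
    such a sequence translates its chain; so a translation-invariant subgroup
    [N] has a normal preimage. *)
Lemma lift_normal_words (N : set (dart K -> int)) : is_subgroup N ->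
  (forall t c, N c -> N (translate t c)) ->
  normal_words (fun p => w p = 0 /\ N (lift_chain p)).
Proof.
move=> sgN Nt; split.
- split; first exact: path_weight_nil.
  by rewrite /lift_chain /path_chain big_nil; case: sgN.
- move=> y; split.
    by rewrite !path_weight_cons path_weight_nil addr0 weight_inv// subrr.
  rewrite /lift_chain /= -inv_lift_dart /path_chain big_cons big_seq1.
  by rewrite dart_chain_inv subrr; case: sgN.
- move=> p q r [wq Nq].
  have -> : w (p ++ q ++ r) = w (p ++ r) by rewrite !path_weight_cat wq add0r.
  have -> : lift_chain (p ++ q ++ r) =
      lift_chain (p ++ r) + translate (w p) (lift_chain q).
    rewrite !lift_chain_cat wq -[in RHS]addrA; congr +%R.
    by rewrite translate0 addrC.
  have {}Nq := Nt (w p) _ Nq.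
  split=> -[-> H]; split=> //; last exact: subgroupD.
  rewrite -(addrK (translate (w p) (lift_chain q)) (lift_chain _)).
  by case: sgN => _; apply.
Qed.

Lemma lift_chain_H1 t u p : is_path u p u -> w p = 0 ->
  H1 K (translate t (lift_chain p)).
Proof.
move=> /(lift_pathP t) + wp; rewrite wp addr0 => Hp.
rewrite /lift_chain translate_path_chain -lift_path_act addr0.
exact: (H1_loop (@pg_locally_finite _ _ _ K) Hp).
Qed.

(** H_1(K) is spanned by loops, which are lifts of loops in the kernel. So normal
    generators of the kernel give generators of H_1(K) up to translation. *)
Lemma H1_generated_by_kernel (u : vertex G) (rs : seq (seq (dart G))) m :
  connected_graph K -> (size rs <= m)%N ->
  (forall p, p \in rs -> is_path u p u /\ w p = 0) ->
  (forall Z, normal_words Z -> (forall p, p \in rs -> Z p) ->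
     forall p, is_path u p u -> w p = 0 -> Z p) ->
  H1_generated_up_to_translation K m.
Proof.
move=> hK rsm rsP rsgen.
pose c (i : 'I_m) := lift_chain (nth [::] rs i).
have cP t i : H1 K (translate t (c i)).
  rewrite /c; have [lt_i|ge_i] := ltnP i (size rs); last first.
    by rewrite nth_default//; apply: (@lift_chain_H1 t u); rewrite ?path_weight_nil.
  by have [Hp wp] := rsP _ (mem_nth [::] lt_i); exact: lift_chain_H1 Hp wp.
exists c; split=> [i|]; first by rewrite -[c i]translate0.
set S := [set z | _]; have sgS := subgroup_gen_subgroup S.
apply/seteqP; split.
  apply: subgroup_gen_min; first exact: H1_subgroup (@pg_locally_finite _ _ _ K).
  by move=> _ [t [i ->]].
have St t z : subgroup_gen S z -> subgroup_gen S (translate t z).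
  move: z; apply: subgroup_gen_min.
    by split=> [|a b Sa Sb]; [case: sgS | case: sgS => _; exact].
  move=> _ [t' [i ->]] /=; rewrite translateD; apply: mem_subgroup_gen.
  by exists (t + t'), i.
have nZ := lift_normal_words sgS St.
apply: (H1_generated_by_loops (u := vtilde u)) => // p Hp.
have [] := project_path Hp; rewrite vtildeK vshift_vtilde0 subrr => Hq liftp wq.
have [_] : w (map (@qd _ _ _ K) p) = 0 /\
    subgroup_gen S (lift_chain (map (@qd _ _ _ K) p)).
  apply: (rsgen _ nZ) => // r rrs.
  split; first by case: (rsP r rrs).
  have lt_r : (index r rs < m)%N by rewrite (leq_trans _ rsm)// index_mem.
  apply: mem_subgroup_gen; exists 0, (Ordinal lt_r).
  by rewrite translate0 /c nth_index.
by rewrite /lift_chain liftp.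
Qed.

End Lift.

Theorem theorem10 (R : realType) (d l : nat) (hd : (0 < d)%N) (hl : (d <= l)%N)
  (K : periodic_graph R d l) (hK : connected_graph K)
  (nu eps g : nat)
  (hnu : [set: vertex (quotient_graph K)] #= `I_nu)
  (heps : edges (quotient_graph K) #= `I_eps)
  (hg : eps%:Z - nu%:Z + 1 = g%:Z) (hgd : (d < g)%N)
  (vtilde : vertex (quotient_graph K) -> vertex K)
  (hvtilde : representatives vtilde)
  (v : vertex (quotient_graph K)) :
  exists s : nat,
    [/\ weight_rank vtilde v g s,
        (d <= s <= g)%N &
        H1_generated_up_to_translation K (g - d + 'C(s, 2))].
Proof.
have wD := path_weight_cat vtilde.
have wN := path_weight_rev hvtilde.
have wH := path_weight_homotopic hvtilde.
have [L0 L0min L0size] := pi1_rank v (quotient_connected hvtilde hK)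
  hnu heps hg (leq_ltn_trans (leq0n d) hgd).
have sizes_ex : exists k, is_min (generating_weight_sizes vtilde L0) k.
  pose S := [fset t in map (path_weight vtilde) L0]%fset.
  apply: (@is_min_exists _ #|` S|); exists S; split=> //.
    by move=> t; rewrite !inE.
  apply/seteqP; split=> // t _.
  have [p Hp <-] := path_weight_surj hvtilde v t hK.
  have := generates_pi1_subgroup wD wN (wH v v) L0min.1 Hp.
  apply: subgroup_gen_min; first exact: subgroup_gen_subgroup.
  move=> _ [q qL <-]; apply: mem_subgroup_gen => /=.
  by rewrite !inE; exact: (map_f (path_weight vtilde) qL).
have [k kmin] := sizes_ex.
have [s smin] := @is_min_exists [set k | exists L,
  [/\ minimal_generating_pi1 v L, size L = g &
      is_min (generating_weight_sizes vtilde L) k]] k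
  (ex_intro _ L0 (And3 L0min L0size kmin)).
exists s; have [[L [[Lgen _] Lsize [[S [SL Sgen Ssize]] _]]] _] := smin.
have [L1 [L2 [LE L1E]]] := perm_split_map (fset_uniq S) SL.
have L1size : size L1 = s by rewrite -Ssize -L1E size_map.
have L1gen : subgroup_gen [set` map (path_weight vtilde) L1] = setT.
  by rewrite L1E.
have [A AW] := generators_right_inverse L1gen.
have ds : (d <= s)%N by have := mulmx1_min AW; rewrite size_map L1size.
split=> //.
  by rewrite ds -Lsize (perm_size LE) size_cat L1size leq_addr.
have [rs [rsize rsP rsgen]] :=
  kernel_normal_generators wD wN (wH v v) Lgen LE L1gen.
apply: (H1_generated_by_kernel hvtilde hK _ rsP rsgen).
by rewrite rsize Lsize L1size.
Qed.
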